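(* Let $d\in\mathbb{N}^*$ and consider the aggregation rate $a(p,p')=|p-p'|^2$ on $\mathbb{R}^d\times\mathbb{R}^d$. There exists a numerical constant $k_d\in(0,\infty)$, with $k_1=1$, such that for any radially symmetric initial datum $f_{in}\in M^1_6(\mathbb{R}^d)$ the unique radially symmetric solution $f\in C([0,T];M^1(\mathbb{R}^d))\cap L^\infty(0,T;M^1_6(\mathbb{R}^d))$ of $$\partial_t f=Q(f,f)\ \text{ in }(0,\infty)\times\mathbb{R}^d,\qquad f(0)=f_{in},$$ satisfies, for any $t\ge 0$, $$M_0(t)=\frac{M_0(0)}{(M_2(0)^{-1}+2\,k_d\,t)^{1/(2k_d)}},$$ $$M_2(t)=\frac{1}{M_2(0)^{-1}+2\,k_d\,t},$$ $$M_4(t)=M_4(0)\,(M_2(0)^{-1}+2\,k_d\,t)^{1/k_d-2},$$ where $M_\alpha(t)=\int_{\mathbb{R}^d}|p|^\alpha f(t,dp)$.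
   Context: The unknown $f(t,\cdot)$ is a nonnegative density (Radon measure) on $\mathbb{R}^d$. The collision operator is $Q(f,f)=Q_1(f,f)-Q_2(f,f)$ with $$Q_1(f,f)(p)=\frac12\int_{\mathbb{R}^d}a(p',p-p')\,f(p')\,f(p-p')\,dp',\qquad Q_2(f,f)(p)=\int_{\mathbb{R}^d}a(p,p')\,f(p)\,f(p')\,dp'.$$ A function $f$ on $\mathbb{R}^d$ is even if $f(-p)=f(p)$ for all $p$, and radially symmetric if $f(Rp)=f(p)$ for all $p\in\mathbb{R}^d$ and all rotations $R\in SO(d)$; for $d=1$, radially symmetric is read as even. $M^1(\mathbb{R}^d)$ denotes the finite Radon measures and $M^1_\alpha(\mathbb{R}^d)$ the set of Radon measures $\mu$ on $\mathbb{R}^d$ with $\int(1+|p|^\alpha)\,|\mu|(dp)<\infty$. The solution referred to is the one given by the paper's existence and uniqueness theorem for the rates $|p-p'|^\gamma$, $\gamma\in[0,2]$: for any even $f_{in}\in M^1_{2\alpha}$, $\alpha$ an integer $\ge 2$, there is a unique even solution in $C([0,T);M^1(\mathbb{R}^d)\text{-weak})\cap L^\infty(0,T;M^1_{2\alpha}(\mathbb{R}^d))$, and it is radially symmetric for all $t\ge0$ if $f_{in}$ is.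
   Formalization: In the formulas for M_0(t) and M_4(t) the base M_2(0)^{-1}+2k_d t is replaced by 1+2k_d M_2(0) t, since as printed they fail at t=0 unless M_2(0)=1; the M_2 formula is unchanged, with M_2(0)^{-1} read as infinity when M_2(0)=0. *)

(* Defs.v *)
From HB Require Import structures.
From mathcomp Require Import all_boot all_order all_algebra.
From mathcomp Require Import all_classical all_reals all_analysis.

Set Implicit Arguments.
Unset Strict Implicit.
Unset Printing Implicit Defensive.

Import Order.TTheory GRing.Theory Num.Theory.
Import numFieldNormedType.Exports.

Local Open Scope classical_set_scope.
Local Open Scope ring_scope.

(* R^d with its Borel sigma-algebra; every finite measure on it is Radon. *)
Definition borel_rV (R : realType) (d : nat) :=
  g_sigma_algebraType (@open 'rV[R]_d).

Notation posM1 R d := {finite_measure set (borel_rV R d) -> \bar R}.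

(* Euclidean norm; the library norm on 'rV[R]_d is the sup norm. *)
Definition enorm (R : realType) (d : nat) (p : 'rV[R]_d) : R :=
  Num.sqrt (\sum_(i < d) p ord0 i ^+ 2).

Definition moment (R : realType) (d n : nat) (mu : posM1 R d) : \bar R :=
  (\int[mu]_p (enorm p ^+ n)%:E)%E.

Definition M1norm (R : realType) (d n : nat) (mu : posM1 R d) : \bar R :=
  (\int[mu]_p (1 + enorm p ^+ n)%:E)%E.

Definition rotation (R : realType) (d : nat) (O : 'M[R]_d) : Prop :=
  O *m O^T = 1%:M /\ \det O = 1.

Definition even_measure (R : realType) (d : nat) (mu : posM1 R d) : Prop :=
  forall A : set 'rV[R]_d, measurable (A : set (borel_rV R d)) ->
    mu ((fun p : 'rV[R]_d => - p) @^-1` A) = mu A.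

(* SO(1) is trivial, whence the separate clause for d = 1. *)
Definition radial (R : realType) (d : nat) (mu : posM1 R d) : Prop :=
  if d == 1%N then even_measure mu
  else forall O : 'M[R]_d, rotation O ->
    forall A : set 'rV[R]_d, measurable (A : set (borel_rV R d)) ->
      mu ((fun p : 'rV[R]_d => p *m O) @^-1` A) = mu A.

Definition bounded_continuous (R : realType) (d : nat) (phi : 'rV[R]_d -> R) :=
  continuous phi /\ exists C : R, forall p, `|phi p| <= C.

Definition cont_compact_support (R : realType) (d : nat)
    (phi : 'rV[R]_d -> R) :=
  continuous phi /\ compact (closure [set p | phi p != 0]).

Section collision.
Context (R : realType) (d : nat).
Variable a : 'rV[R]_d -> 'rV[R]_d -> R.
Implicit Types (phi : 'rV[R]_d -> R) (mu : posM1 R d).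

(* Q1 mu and Q2 mu tested against phi. In Q1 the change of variables
   (p, p') |-> (p', q) with q = p - p' turns
   1/2 \int phi p \int a p' (p - p') mu(p') mu(p - p') dp' dp into an
   expression that makes sense for measures. *)
Definition Q1 mu phi : R :=
  2^-1 * \int[mu]_p' \int[mu]_q
    (a p' q * phi ((p' : 'rV[R]_d) + (q : 'rV[R]_d))).

Definition Q2 mu phi : R :=
  \int[mu]_p \int[mu]_p' (a p p' * phi p).

Definition Q mu phi : R := Q1 mu phi - Q2 mu phi.

(* f is a solution of d_t f = Q(f,f) on (0,oo) x R^d, f(0) = fin, in
   C([0,T]; M^1-weak) \cap L^oo(0,T; M^1_n) for every T > 0; the equation is
   the distributional one, integrated in time. Only the values of f at
   nonnegative times matter. *)
Definition solution (n : nat) (fin : posM1 R d) (f : R -> posM1 R d) : Prop :=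
  [/\ forall A : set (borel_rV R d), measurable A -> f 0 A = fin A,
      forall (T : R) phi, 0 < T -> bounded_continuous phi ->
        {within `[0, T], continuous (fun t => \int[f t]_p phi p)},
      forall T : R, 0 < T -> exists C : R,
        {ae @lebesgue_measure R, forall t, t \in `]0, T[ ->
           (M1norm n (f t) <= C%:E)%E} &
      forall phi, cont_compact_support phi -> forall t : R, 0 <= t ->
        (@lebesgue_measure R).-integrable `[0, t]
          (fun s => (Q (f s) phi)%:E) /\
        \int[f t]_p phi p = \int[fin]_p phi p +
          \int[@lebesgue_measure R]_(s in `[0, t]) Q (f s) phi].

End collision.

(* Main.v *)
(** Testing the equation against 1, |p|^2 and |p|^4 gives a closed system for the
    moments. With [m_j] the moment of order [2j], it reads [m_j' = c_j m_1 m_j],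
    where [c_0 = -1], [c_1 = -2/d], [c_2 = 2 - 4/d] (the sixth moment cancels for
    [j = 2]), because a radial measure has vanishing odd moments and
    [int q_i q_j |q|^(2l) = delta_ij m_(l+1) / d]. Hence [k_d = 1/d]: with
    [E(t) = int_0^t m_1] one gets [m_j = m_j(0) exp(c_j E)], and
    [exp(2 k_d E)' = 2 k_d m_1(0)] determines [E].
    The admissible test functions being compactly supported, the powers of |p|
    are reached by cutoffs: since
    [|p - q|^2 |p + q|^(2j) <= 8 (1 + |p|^2)^3 (1 + |q|^2)^3] for [j <= 2], the
    sixth moment dominates the collision term, while the left-hand side converges
    by monotonicity. *)
Require Import Defs.
From HB Require Import structures.
From mathcomp Require Import all_boot all_order all_algebra.
From mathcomp Require Import all_classical all_reals all_analysis.
From mathcomp Require Import measurable_realfun perm ring lra.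

Set Implicit Arguments.
Unset Strict Implicit.
Unset Printing Implicit Defensive.

Import Order.TTheory GRing.Theory Num.Theory.
Import numFieldNormedType.Exports.

Local Open Scope classical_set_scope.
Local Open Scope ring_scope.

(** * Dominated convergence, sequential continuity, Borel measurability *)

Lemma Rdominated_convergence {disp : measure_display} {T : measurableType disp}
    {R : realType} (mu : {measure set T -> \bar R}) (D : set T)
    (u_ : nat -> T -> R) (u g : T -> R) :
  measurable D ->
  (forall n, measurable_fun D (u_ n)) ->
  (forall x, D x -> u_ ^~ x @ \oo --> u x) ->
  mu.-integrable D (EFin \o g) ->
  (forall n x, D x -> `|u_ n x| <= g x) ->
  mu.-integrable D (EFin \o u) /\
  (\int[mu]_(x in D) u_ n x) @[n --> \oo] --> \int[mu]_(x in D) u x.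
Proof.
move=> mD mu_ cu ig bu.
have mu' : measurable_fun D u by exact: (measurable_fun_cvg mu_ cu).
have [|||||i1 _ c1] := @dominated_convergence _ _ _ mu D mD
  (fun n => EFin \o u_ n) (EFin \o u) (EFin \o g).
- by move=> n; apply/measurable_EFinP.
- exact/measurable_EFinP.
- by apply: aeW => x Dx; apply: cvg_EFin; [exact: nearW|exact: cu].
- exact: ig.
- by apply: aeW => x n Dx; rewrite lee_fin; exact: bu.
split => //; apply: fine_cvg.
by rewrite fineK//; exact: integrable_fin_num.
Qed.

(** Were continuity to fail at scale [e], a bad point chosen in each ball of radius [1/(n+1)] would
    form a sequence contradicting the hypothesis. This form lets dominated convergence, a statement
    on sequences, yield continuity of integrals in a parameter. *)
Lemma sequential_continuity {R : realType} {d : nat} (u : 'rV[R]_d -> R)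
    (p : 'rV[R]_d) :
  (forall s : nat -> 'rV[R]_d, s n @[n --> \oo] --> p ->
    u (s n) @[n --> \oo] --> u p) -> {for p, continuous u}.
Proof.
move=> H; suff : u q @[q --> p] --> u p by [].
apply: (iffRL (@cvgrPdist_lt R R^o _ (nbhs p) (nbhs_filter p) u (u p))) => e e0.
apply: contrapT => nH.
have /choice[s Hs] n : exists q, ball p n.+1%:R^-1 q /\ e <= `|u p - u q|.
  apply: contrapT => nq; apply: nH.
  have n0 : 0 < n.+1%:R^-1 :> R by rewrite invr_gt0.
  apply: filterS (nbhsx_ballx p _ n0) => q bq.
  by rewrite ltNge; apply/negP => le; apply: nq; exists q.
have sp : s n @[n --> \oo] --> p.
  apply/cvg_ballP => eps eps0; near=> n.
  apply: (le_ball _ (Hs n).1); apply: ltW.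
  by near: n; exact: near_infty_natSinv_lt (PosNum eps0).
have /cvgrPdist_lt/(_ _ e0)[N _ HN] := H s sp.
by have := HN N (leqnn N); rewrite ltNge (Hs N).2.
Unshelve. all: by end_near. Qed.

Lemma continuous_measurable_borel {R : realType} {d : nat} (u : 'rV[R]_d -> R) :
  continuous u -> measurable_fun [set: borel_rV R d] (u : borel_rV R d -> R).
Proof.
move=> cu; apply: (measurability _ (RGenOpens.measurableE R)).
move=> _ [_ [a [b ->] <-]]; rewrite setTI; apply: sub_sigma_algebra.
by move/continuousP: cu; apply; exact: interval_open.
Qed.

Lemma sum_continuous {R : realType} {T : topologicalType} {I : Type}
    (r : seq I) (F : I -> T -> R) :
  (forall i, continuous (F i)) -> continuous (fun x => \sum_(i <- r) F i x).
Proof. by move=> cF; apply: continuous_big => //; exact: add_continuous. Qed.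

(** * Functions of polynomial growth *)

Section growth.
Context {R : realType} {d : nat}.
Implicit Types (u v : 'rV[R]_d -> R) (p q : 'rV[R]_d) (mu : posM1 R d).

Definition sqnorm p : R := \sum_(i < d) p ord0 i ^+ 2.

Definition dotp p q : R := \sum_(i < d) p ord0 i * q ord0 i.

(** Comparable with [1 + |p|^6], the integrand of [M1norm 6], but a pure power, so that products of
    two such bounds combine easily. *)
Definition weight p : R := (1 + sqnorm p) ^+ 3.

(** The order counts powers of [|p|^2]: order 3 is the class integrable against measures in
    [M^1_6]. *)
Definition grows (k : nat) u : Prop :=
  continuous u /\ exists2 K, 0 <= K & forall p, `|u p| <= K * (1 + sqnorm p) ^+ k.

Lemma sqnorm_ge0 p : 0 <= sqnorm p.
Proof. by apply: sumr_ge0 => i _; exact: sqr_ge0. Qed.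

Lemma enorm_sqr p : enorm p ^+ 2 = sqnorm p.
Proof. by rewrite sqr_sqrtr// sqnorm_ge0. Qed.

Lemma enorm_even_power j p : enorm p ^+ j.*2 = sqnorm p ^+ j.
Proof. by rewrite -mul2n exprM enorm_sqr. Qed.

Lemma sqnormD p q : sqnorm (p + q) = sqnorm p + sqnorm q + 2 * dotp p q.
Proof.
rewrite /sqnorm /dotp mulr_sumr -!big_split; apply: eq_bigr => i _ /=.
by rewrite mxE; ring.
Qed.

Lemma sqnormB p q : sqnorm (p - q) = sqnorm p + sqnorm q - 2 * dotp p q.
Proof.
rewrite /sqnorm /dotp mulr_sumr -sumrN -!big_split; apply: eq_bigr => i _ /=.
by rewrite !mxE; ring.
Qed.

Lemma weight_ge0 p : 0 <= weight p.
Proof. by rewrite exprn_ge0// addr_ge0// sqnorm_ge0. Qed.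

Lemma continuous_coord (i : 'I_d) : continuous (fun p => p ord0 i).
Proof. exact: coord_continuous. Qed.

Lemma continuous_sqnorm : continuous sqnorm.
Proof.
apply: sum_continuous => i p.
exact: (continuous_comp (@continuous_coord i p) (@exprn_continuous _ 2 _)).
Qed.

Lemma growsW k l u : (k <= l)%N -> grows k u -> grows l u.
Proof.
move=> kl [cu [K K0 hK]]; split => //; exists K => // p.
by apply: le_trans (hK p) _; rewrite ler_wpM2l// ler_weXn2l// lerDl sqnorm_ge0.
Qed.

Lemma growsD k u v : grows k u -> grows k v -> grows k (fun p => u p + v p).
Proof.
move=> [cu [K K0 hK]] [cv [L L0 hL]]; split.
  by move=> p; apply: continuousD; [exact: cu|exact: cv].
exists (K + L) => [|p]; first exact: addr_ge0.
by rewrite mulrDl (le_trans (ler_normD _ _))// lerD.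
Qed.

Lemma growsM k l u v :
  grows k u -> grows l v -> grows (k + l) (fun p => u p * v p).
Proof.
move=> [cu [K K0 hK]] [cv [L L0 hL]]; split.
  by move=> p; apply: continuousM; [exact: cu|exact: cv].
exists (K * L) => [|p]; first exact: mulr_ge0.
by rewrite normrM exprD mulrACA ler_pM.
Qed.

Lemma grows_cst (c : R) : grows 0 (fun=> c).
Proof.
split; first exact: cst_continuous.
by exists `|c| => // p; rewrite expr0 mulr1.
Qed.

Lemma growsZ k (c : R) u : grows k u -> grows k (fun p => c * u p).
Proof. exact: growsM (grows_cst c). Qed.

Lemma grows_sum k (I : Type) (r : seq I) (F : I -> 'rV[R]_d -> R) :
  (forall i, grows k (F i)) -> grows k (fun p => \sum_(i <- r) F i p).
Proof.
move=> gF; elim: r => [|i r IH].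
  under eq_fun do rewrite big_nil.
  exact: growsW (grows_cst 0).
under eq_fun do rewrite big_cons.
exact: growsD.
Qed.

Lemma growsX k n u : grows k u -> grows (n * k) (fun p => u p ^+ n).
Proof.
move=> gu; elim: n => [|n IH].
  by under eq_fun do rewrite expr0; exact: grows_cst.
by under eq_fun do rewrite exprS; rewrite mulSn; exact: growsM.
Qed.

Lemma grows_sqnorm : grows 1 sqnorm.
Proof.
split; first exact: continuous_sqnorm.
exists 1 => // p; rewrite mul1r expr1 ger0_norm ?sqnorm_ge0//.
by rewrite lerDr.
Qed.

Lemma grows_sqnormX j : grows j (fun p => sqnorm p ^+ j).
Proof. by rewrite -{1}[j]muln1; exact: growsX grows_sqnorm. Qed.

Lemma le_coordM_sqnorm (i j : 'I_d) p :
  `|p ord0 i * p ord0 j| <= sqnorm p.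
Proof.
have sq k : p ord0 k ^+ 2 <= sqnorm p.
  by rewrite /sqnorm (bigD1 k)//= lerDl sumr_ge0// => l _; exact: sqr_ge0.
rewrite normrM; have := sq i; have := sq j.
rewrite -[p ord0 i ^+ 2]real_normK ?num_real// -[p ord0 j ^+ 2]real_normK ?num_real//.
set x := `|_|; set y := `|_|; have := sqr_ge0 (x - y); nra.
Qed.

(** The true order 1/2 is rounded up to 1 by [x <= 1 + x^2]. *)
Lemma grows_coord (i : 'I_d) : grows 1 (fun p => p ord0 i).
Proof.
split; first exact: continuous_coord.
exists 1 => // p; rewrite mul1r expr1; have := le_coordM_sqnorm i i p.
rewrite normrM; have := normr_ge0 (p ord0 i).
set x := `|_|; have := sqr_ge0 (x - 1); nra.
Qed.

Lemma grows_coord2 (i j : 'I_d) : grows 1 (fun p => p ord0 i * p ord0 j).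
Proof.
split.
  by move=> p; apply: continuousM; exact: continuous_coord.
exists 1 => // p; rewrite mul1r expr1 (le_trans (le_coordM_sqnorm i j p))//.
by rewrite lerDr.
Qed.

Lemma grows_dotp p : grows 1 (dotp p).
Proof. by apply: grows_sum => i; exact: growsZ (grows_coord i). Qed.

Lemma weight_le p : weight p <= 4 * (1 + sqnorm p ^+ 3).
Proof.
rewrite /weight; have := sqnorm_ge0 p; set s := sqnorm p => s0.
(* [4 (1 + s^3) - (1 + s)^3 = 3 (1 - s)^2 (1 + s)]. *)
have : 0 <= (1 - s) ^+ 2 * (1 + s) by rewrite mulr_ge0 ?sqr_ge0 ?addr_ge0.
move=> h; rewrite -subr_ge0.
by apply: le_trans (_ : 3 * ((1 - s) ^+ 2 * (1 + s)) <= _); lra.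
Qed.

Lemma M1norm6E mu : M1norm 6 mu = (\int[mu]_p (1 + sqnorm p ^+ 3)%:E)%E.
Proof. by apply: eq_integral => p _; rewrite (enorm_even_power 3). Qed.

Lemma integrable_M1norm6 mu : (M1norm 6 mu < +oo)%E ->
  mu.-integrable setT (EFin \o (fun p => 1 + sqnorm p ^+ 3)).
Proof.
have [c6 _] := growsD (growsW (isT : 0 <= 3)%N (grows_cst 1)) (grows_sqnormX 3).
rewrite M1norm6E => mu6; apply/integrableP; split.
  by apply/measurable_EFinP; exact: continuous_measurable_borel.
move: mu6; congr (_ < _)%E; apply: eq_integral => p _ /=.
by rewrite ger0_norm// addr_ge0// exprn_ge0// sqnorm_ge0.
Qed.

(** A function of order 3 is dominated by a multiple of [weight], hence of [1 + |p|^6]. The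
    integrability of all polynomial integrands below comes from here. *)
Lemma grows_integrable mu u : (M1norm 6 mu < +oo)%E -> grows 3 u ->
  mu.-integrable setT (EFin \o u).
Proof.
move=> mu6 [cu [K K0 hK]].
have := integrableZl measurableT (4 * K) (integrable_M1norm6 mu6).
apply: le_integrable => //.
  by apply/measurable_EFinP; exact: continuous_measurable_borel.
move=> p _ /=; rewrite lee_fin (le_trans (hK p))// (le_trans _ (ler_norm _))//.
by rewrite mulrAC mulrC ler_wpM2r//; exact: weight_le.
Qed.

Lemma grows_weight : grows 3 weight.
Proof.
have /(growsX 3) := growsD (growsW (isT : 0 <= 1)%N (grows_cst 1)) grows_sqnorm.
by rewrite muln1.
Qed.

Lemma weight_le_M1norm mu : (M1norm 6 mu < +oo)%E ->
  \int[mu]_p weight p <= 4 * fine (M1norm 6 mu).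
Proof.
move=> mu6; rewrite M1norm6E.
rewrite -[fine _]/(\int[mu]_p (1 + sqnorm p ^+ 3)) -RintegralZl//; last first.
  exact: integrable_M1norm6.
apply: le_Rintegral => //.
- exact: grows_integrable mu6 grows_weight.
- have := integrableZl measurableT 4 (integrable_M1norm6 mu6). exact.
- by move=> p _; exact: weight_le.
Qed.

Lemma borel_dominated_convergence mu (u_ : nat -> 'rV[R]_d -> R) u v :
  (forall n, measurable_fun [set: borel_rV R d] (u_ n : borel_rV R d -> R)) ->
  (forall p, u_ n p @[n --> \oo] --> u p) ->
  mu.-integrable setT (EFin \o v) ->
  (forall n p, `|u_ n p| <= v p) ->
  \int[mu]_p u_ n p @[n --> \oo] --> \int[mu]_p u p.
Proof.
move=> mu_ cu iv bu.
by have [] := @Rdominated_convergence _ (borel_rV R d) _ mu setT u_ u v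
  measurableT mu_ (fun p _ => cu p) iv (fun n p _ => bu n p).
Qed.

(** * Iterated integrals of kernels dominated by a product of weights *)

Section iterated.
Variables (mu : posM1 R d) (K : R) (g_ : nat -> 'rV[R]_d -> 'rV[R]_d -> R).
Hypothesis mu6 : (M1norm 6 mu < +oo)%E.
Hypothesis cg1 : forall n q, continuous (fun p => g_ n p q).
Hypothesis cg2 : forall n p, continuous (g_ n p).
Hypothesis bg : forall n p q, `|g_ n p q| <= K * (weight p * weight q).

Let iweight : mu.-integrable setT (EFin \o weight).
Proof. exact: grows_integrable mu6 grows_weight. Qed.

Let bweight (c : R) : mu.-integrable setT (EFin \o (fun q => c * weight q)).
Proof. have := integrableZl measurableT c iweight; exact. Qed.

Let inner n p := \int[mu]_q g_ n p q.

Let ig2 n p : mu.-integrable setT (EFin \o g_ n p).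
Proof.
apply: le_integrable (bweight (K * weight p)) => //.
  by apply/measurable_EFinP; apply: continuous_measurable_borel; exact: cg2.
move=> q _ /=; rewrite lee_fin (le_trans (bg n p q))// mulrA ler_norm//.
Qed.

(* Continuity makes the inner integral Borel in [p]; no product sigma-algebra is
   needed. *)
Let continuous_inner n : continuous (inner n).
Proof.
move=> p; apply: sequential_continuity => s sp.
have [M sM] : exists M, forall m, `|weight (s m)| <= M.
  have : cvgn (weight \o s).
    apply/cvg_ex; exists (weight p); apply: continuous_cvg => //.
    by have [cw _] := grows_weight; exact: cw.
  move=> /cvg_seq_bounded[M [_ HM]]; exists (M + 1) => m.
  by apply: HM => //; rewrite ltrDl.
have K0 : 0 <= K * weight p * weight p.
  by rewrite -mulrA (le_trans _ (bg 0 p p)).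
have iM : mu.-integrable setT (EFin \o (fun q => `|K| * M * weight q)) by [].
apply: (borel_dominated_convergence _ _ iM).
- by move=> m; apply: continuous_measurable_borel; exact: cg2.
- by move=> q; have := cvg_comp s (fun p => g_ n p q) sp (@cg1 n q p).
- move=> m q; rewrite (le_trans (bg _ _ _))//.
  rewrite mulrA ler_wpM2r ?weight_ge0// (le_trans (ler_norm _))// normrM.
  by rewrite ler_wpM2l.
Qed.

Let bound_inner n p : `|inner n p| <= K * \int[mu]_q weight q * weight p.
Proof.
rewrite (le_trans (le_normr_Rintegral _ (ig2 n p)))//.
rewrite mulrAC -RintegralZl//; apply: le_Rintegral => //.
- exact: integrable_norm.
- by move=> q _; rewrite -mulrA.
Qed.

Let iinner n : mu.-integrable setT (EFin \o inner n).
Proof.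
apply: le_integrable (bweight (K * \int[mu]_q weight q)) => //.
  by apply/measurable_EFinP; apply: continuous_measurable_borel; exact: continuous_inner.
by move=> p _ /=; rewrite lee_fin (le_trans (bound_inner n p))// ler_norm.
Qed.

(** Integrating the product bound in [q] leaves a multiple of [weight p], which is then integrated
    in [p]. *)
Lemma iterated_bound n :
  `|\int[mu]_p \int[mu]_q g_ n p q| <= K * (\int[mu]_q weight q) ^+ 2.
Proof.
rewrite (le_trans (le_normr_Rintegral _ (iinner n)))//.
rewrite expr2 mulrA -RintegralZl//; apply: le_Rintegral => //.
exact: integrable_norm.
Qed.

(** Dominated convergence twice: in [q] at fixed [p], with bound [K * weight p * weight q], then in
    [p], with the bound on [inner]. *)
Lemma iterated_cvg (g : 'rV[R]_d -> 'rV[R]_d -> R) :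
  (forall p q, g_ n p q @[n --> \oo] --> g p q) ->
  \int[mu]_p \int[mu]_q g_ n p q @[n --> \oo] --> \int[mu]_p \int[mu]_q g p q.
Proof.
move=> cg.
have iK c : mu.-integrable setT (EFin \o (fun q => c * weight q)) by [].
apply: (@borel_dominated_convergence _ inner _ _ _ _
  (iK (K * \int[mu]_q weight q))) => //.
- by move=> n; apply: continuous_measurable_borel; exact: continuous_inner.
- move=> p.
  apply: (borel_dominated_convergence _ _ (iK (K * weight p))) => //.
  + by move=> n; apply: continuous_measurable_borel; exact: cg2.
  + by move=> n q; rewrite -mulrA.
Qed.

End iterated.
End growth.

(** * Cutoffs of the powers of the norm *)

Section cutoff.
Context {R : realType} {d : nat}.
Implicit Types (p q : 'rV[R]_d) (mu : posM1 R d).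

(** A trapezoid in [|p|^2]: 1 up to [n + 1], 0 from [2 (n + 1)] on, affine in between. It increases
    with [n], as monotone convergence requires. *)
Definition cutoff (n : nat) p : R :=
  Num.max 0 (Num.min 1 (2 - sqnorm p / n.+1%:R)).

Definition cutpow (j n : nat) p : R := cutoff n p * sqnorm p ^+ j.

Lemma cutoff_ge0 n p : 0 <= cutoff n p.
Proof. by rewrite /cutoff le_max lexx. Qed.

Lemma cutoff_le1 n p : cutoff n p <= 1.
Proof. by rewrite /cutoff ge_max ler01 ge_min lexx. Qed.

Lemma cutoff_nondecreasing m n p : (m <= n)%N -> cutoff m p <= cutoff n p.
Proof.
move=> mn; rewrite /cutoff le_max2// le_min2// lerD2l lerN2 ler_wpM2l ?sqnorm_ge0//.
by rewrite lef_pV2 ?posrE// ler_nat.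
Qed.

Lemma cutoff_eq1 n p : sqnorm p <= n.+1%:R -> cutoff n p = 1.
Proof.
move=> pn; have : sqnorm p / n.+1%:R <= 1 by rewrite ler_pdivrMr// mul1r.
rewrite /cutoff; set x := _ / _ => h; rewrite min_l ?max_r//; lra.
Qed.

Lemma cutoff_eq0 n p : 2 * n.+1%:R <= sqnorm p -> cutoff n p = 0.
Proof.
move=> pn; have : 2 <= sqnorm p / n.+1%:R by rewrite ler_pdivlMr.
rewrite /cutoff; set x := _ / _ => h.
by rewrite max_l// ge_min; apply/orP; right; lra.
Qed.

Lemma cutoff_cvg p : cutoff n p @[n --> \oo] --> (1 : R).
Proof.
apply: cvg_near_cst; near=> n; apply: cutoff_eq1.
have : `|sqnorm p|%R <= n%:R by near: n; exact: nbhs_infty_ger.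
rewrite ger0_norm ?sqnorm_ge0// => /le_trans; apply; by rewrite ler_nat.
Unshelve. all: by end_near. Qed.

Lemma continuous_cutoff n : continuous (cutoff n).
Proof.
move=> p.
have c : {for p, continuous (fun p => 2 - sqnorm p / n.+1%:R)}.
  apply: continuousB; first exact: cst_continuous.
  by apply: continuousM; [exact: continuous_sqnorm|exact: cst_continuous].
apply: (@continuous_max _ _ (fun=> 0) (fun p => Num.min 1 (2 - sqnorm p / n.+1%:R))).
  exact: cst_continuous.
apply: (@continuous_min _ _ (fun=> 1)) c.
exact: cst_continuous.
Qed.

Lemma continuous_sqnormX j : continuous (fun p => sqnorm p ^+ j).
Proof. by have [] := @grows_sqnormX R d j. Qed.

Lemma continuous_cutpow j n : continuous (cutpow j n).
Proof.
move=> p; apply: continuousM; first exact: continuous_cutoff.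
exact: continuous_sqnormX.
Qed.

Lemma cutpow_cvg j p : cutpow j n p @[n --> \oo] --> sqnorm p ^+ j.
Proof.
rewrite -[X in _ --> X]mul1r.
by apply: cvgM; [exact: cutoff_cvg|exact: cvg_cst].
Qed.

Lemma cutpow_ge0 j n p : 0 <= cutpow j n p.
Proof. by rewrite mulr_ge0 ?cutoff_ge0 ?exprn_ge0 ?sqnorm_ge0. Qed.

Lemma cutpow_le j n p : cutpow j n p <= sqnorm p ^+ j.
Proof. by rewrite ler_piMl ?cutoff_le1 ?exprn_ge0 ?sqnorm_ge0. Qed.

Lemma cutpow_bounded j n p : cutpow j n p <= (2 * n.+1%:R) ^+ j.
Proof.
have [pn|pn] := leP (sqnorm p) (2 * n.+1%:R).
  by rewrite (le_trans (cutpow_le _ _ _))// lerXn2r// nnegrE ?sqnorm_ge0.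
by rewrite /cutpow cutoff_eq0 ?mul0r ?exprn_ge0// ltW.
Qed.

Lemma cutpow_compact_support j n : cont_compact_support (cutpow j n).
Proof.
split; first exact: continuous_cutpow.
have clo : closed [set p : 'rV[R]_d | sqnorm p <= 2 * n.+1%:R].
  have -> : [set p : 'rV[R]_d | sqnorm p <= 2 * n.+1%:R] =
    sqnorm @^-1` [set x | x <= 2 * n.+1%:R] by [].
  by apply: closed_comp; [move=> p _; exact: continuous_sqnorm|exact: closed_le].
have sub : closure [set p | cutpow j n p != 0] `<=`
    [set p : 'rV[R]_d | sqnorm p <= 2 * n.+1%:R].
  rewrite [X in _ `<=` X](closure_id _).1//; apply: closure_subset => p /= h.
  rewrite leNgt; apply/negP => /ltW h'; move: h.
  by rewrite /cutpow cutoff_eq0// mul0r eqxx.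
apply: bounded_closed_compact; last exact: closed_closure.
(* The sup-norm radius comes from [|p_k| <= 1 + p_k^2 <= 1 + |p|^2 <= 1 + 2 (n + 1)]. *)
exists (1 + 2 * n.+1%:R); split => [|x xn p /sub/= pn]; first exact: num_real.
have n0 : 0 <= n%:R :> R by [].
rewrite [leLHS]/Num.norm/= mx_normrE; apply/bigmax_leP; split => [|[i k] _ /=].
  by rewrite ltW// (le_lt_trans _ xn)// addr_ge0.
rewrite ord1 (le_trans _ (ltW xn))//.
apply: le_trans (_ : 1 + sqnorm p <= _); last by rewrite lerD2l.
have := le_coordM_sqnorm k k p; rewrite normrM.
have := normr_ge0 (p ord0 k); set z := `|_|; have := sqr_ge0 (z - 1); nra.
Qed.

(** With [X = 2 (1 + |p|^2) (1 + |q|^2) >= 1], the left side is at most [X * X^j <= X^3], and [X^3]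
    is the right side. It serves with [x = |p - q|^2] and with [y = |p + q|^2] for the gain,
    [y = |p|^2] for the loss. *)
Lemma two_point_bound p q (j : nat) (x y : R) : (j <= 2)%N ->
  0 <= x <= 2 * ((1 + sqnorm p) * (1 + sqnorm q)) ->
  0 <= y <= 2 * ((1 + sqnorm p) * (1 + sqnorm q)) ->
  x * y ^+ j <= 8 * (weight p * weight q).
Proof.
move=> j2 /andP[x0 xX] /andP[y0 yX].
rewrite -exprMn; set X := 2 * _ in xX yX.
have X1 : 1 <= X.
  by rewrite /X; have := sqnorm_ge0 p; have := sqnorm_ge0 q; nra.
have -> : 8 * ((1 + sqnorm p) * (1 + sqnorm q)) ^+ 3 = X * X ^+ 2.
  by rewrite /X; ring.
have X0 : 0 <= X by exact: le_trans X1.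
apply: ler_pM => //; first exact: exprn_ge0.
apply: le_trans (_ : X ^+ j <= _); last by rewrite ler_weXn2l.
by rewrite lerXn2r.
Qed.

(** By the parallelogram law, [|p - q|^2] and [|p + q|^2] are at most [2 (|p|^2 + |q|^2)]. *)
Lemma sqnorm_range p q : let X := 2 * ((1 + sqnorm p) * (1 + sqnorm q)) in
  [/\ 0 <= sqnorm p <= X, 0 <= sqnorm (p - q) <= X & 0 <= sqnorm (p + q) <= X].
Proof.
rewrite /= !sqnorm_ge0/=.
have : sqnorm (p + q) + sqnorm (p - q) = 2 * (sqnorm p + sqnorm q).
  by rewrite sqnormD sqnormB; ring.
have := sqnorm_ge0 p; have := sqnorm_ge0 q.
have := sqnorm_ge0 (p - q); have := sqnorm_ge0 (p + q).
by split; nra.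
Qed.

Definition rate p q : R := enorm (p - q) ^+ 2.

Let cont_sub q : continuous (fun p => p - q).
Proof. by move=> p; apply: continuousB; [exact: id|exact: cst_continuous]. Qed.

Let cont_add q : continuous (fun p => p + q).
Proof. by move=> p; apply: continuousD; [exact: id|exact: cst_continuous]. Qed.

Let rateE p q : rate p q = sqnorm (p - q).
Proof. exact: enorm_sqr. Qed.

Let rateC p q : rate p q = rate q p.
Proof.
by rewrite !rateE !sqnormB /dotp; under eq_bigr do rewrite mulrC; ring.
Qed.

Let continuous_rate p : continuous (rate^~ p).
Proof.
have -> : rate^~ p = (fun q => sqnorm (q - p)) by apply/funext => q.
by move=> q; apply: (continuous_comp (@cont_sub p q)); exact: continuous_sqnorm.
Qed.

Let continuous_rater p : continuous (rate p).
Proof.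
have -> : rate p = rate^~ p by apply/funext => q; exact: rateC.
exact: continuous_rate.
Qed.

(** * The collision operator on cutoff powers: [g1] is the gain integrand, [g2] the loss
    integrand *)

Section fixed_measure.
Variables (mu : posM1 R d) (j : nat).
Hypothesis mu6 : (M1norm 6 mu < +oo)%E.
Hypothesis j2 : (j <= 2)%N.

Let g1 (n : nat) p q := rate p q * cutpow j n (p + q).
Let g2 (n : nat) p q := rate p q * cutpow j n p.

Let cg1l n q : continuous (g1 n ^~ q).
Proof.
move=> p; apply: (@continuousM _ _ (rate^~ q) (fun p => cutpow j n (p + q))).
  exact: continuous_rate.
by apply: (continuous_comp (@cont_add q p)); exact: continuous_cutpow.
Qed.

Let cg1r n p : continuous (g1 n p).
Proof.
move=> q; apply: (@continuousM _ _ (rate p) (fun q => cutpow j n (p + q))).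
  exact: continuous_rater.
have -> : (fun q => cutpow j n (p + q)) = (fun q => cutpow j n (q + p)).
  by apply/funext => q'; rewrite addrC.
by apply: (continuous_comp (@cont_add p q)); exact: continuous_cutpow.
Qed.

Let cg2l n q : continuous (g2 n ^~ q).
Proof.
move=> p; apply: (@continuousM _ _ (rate^~ q) (cutpow j n)).
  exact: continuous_rate.
exact: continuous_cutpow.
Qed.

Let cg2r n p : continuous (g2 n p).
Proof.
move=> q; apply: (@continuousM _ _ (rate p) (fun=> cutpow j n p)).
  exact: continuous_rater.
exact: cst_continuous.
Qed.

Let bg1 n p q : `|g1 n p q| <= 8 * (weight p * weight q).
Proof.
have [_ hm hp] := sqnorm_range p q.
rewrite normrM !ger0_norm ?cutpow_ge0 ?rateE ?sqnorm_ge0//.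
apply: le_trans (two_point_bound j2 hm hp).
by rewrite ler_wpM2l ?sqnorm_ge0// cutpow_le.
Qed.

Let bg2 n p q : `|g2 n p q| <= 8 * (weight p * weight q).
Proof.
have [h0 hm _] := sqnorm_range p q.
rewrite normrM !ger0_norm ?cutpow_ge0 ?rateE ?sqnorm_ge0//.
apply: le_trans (two_point_bound j2 hm h0).
by rewrite ler_wpM2l ?sqnorm_ge0// cutpow_le.
Qed.

Lemma Q_cutpow_cvg :
  Q rate mu (cutpow j n) @[n --> \oo] --> Q rate mu (fun p => sqnorm p ^+ j).
Proof.
apply: cvgB.
  apply: cvgM; first exact: cvg_cst.
  apply: (iterated_cvg mu6 cg1l cg1r bg1) => p q.
  by apply: cvgM; [exact: cvg_cst|exact: cutpow_cvg].
apply: (iterated_cvg mu6 cg2l cg2r bg2) => p q.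
by apply: cvgM; [exact: cvg_cst|exact: cutpow_cvg].
Qed.

(** The constant is [8/2 + 8], the gain carrying a factor 1/2. Being uniform in [n], the bound later
    gives the domination in time. *)
Lemma Q_cutpow_bound n :
  `|Q rate mu (cutpow j n)| <= 12 * (\int[mu]_q weight q) ^+ 2.
Proof.
have h1 := iterated_bound mu6 cg1l cg1r bg1 n.
have h2 := iterated_bound mu6 cg2l cg2r bg2 n.
rewrite /Q /Q1 /Q2 (le_trans (ler_normB _ _))// normrM gtr0_norm//.
rewrite -/(g1 n) -/(g2 n).
set I := Rintegral _ _ _ in h1 *; lra.
Qed.

End fixed_measure.
End cutoff.

(** * Moments of radial measures *)

Section radial_moments.
Context {R : realType} {d : nat}.
Implicit Types (p q : 'rV[R]_d) (mu : posM1 R d) (u : 'rV[R]_d -> R).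

Lemma rV_continuous (T : topologicalType) (F : T -> 'rV[R]_d) :
  (forall i, continuous (fun x => F x ord0 i)) -> continuous F.
Proof.
move=> cF x; apply/cvg_ballP => e e0.
have H : \forall y \near x, forall k : 'I_d, ball (F x ord0 k) e (F y ord0 k).
  apply: filter_forall => k; apply: (cF k x); exact: nbhsx_ballx.
apply: filterS H => y yx; split => // i k.
by rewrite ord1; exact: yx.
Qed.

(** Invariance is tested on integrals of functions of order 3, the only ones to which symmetries are
    applied below. *)
Definition invariant mu (S : 'rV[R]_d -> 'rV[R]_d) : Prop :=
  forall u, grows 3 u -> \int[mu]_p u (S p) = \int[mu]_p u p.

(** Change of variables: the image measure of [mu] under [S] agrees with [mu] on Borel sets, and
    [u \o S] keeps its growth because [S] preserves the norm. *)
Lemma invariant_image mu (S : 'rV[R]_d -> 'rV[R]_d) :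
  (M1norm 6 mu < +oo)%E -> continuous S -> (forall p, sqnorm (S p) = sqnorm p) ->
  (forall A : set 'rV[R]_d, measurable (A : set (borel_rV R d)) ->
    mu (S @^-1` A) = mu A) ->
  invariant mu S.
Proof.
move=> mu6 cS nS muS u gu.
have mS : measurable_fun [set: borel_rV R d] (S : borel_rV R d -> borel_rV R d).
  apply: (@measurability _ _ (borel_rV R d) (borel_rV R d) setT S
    (@open 'rV[R]_d)) => //.
  move=> _ [A oA <-]; rewrite setTI; apply: sub_sigma_algebra.
  by move/continuousP : cS; exact.
have guS : grows 3 (u \o S).
  case: gu => cu [K K0 hK]; split.
    by move=> p; apply: continuous_comp; [exact: cS|exact: cu].
  by exists K => // p; rewrite /= -(nS p).
have := @integral_pushforward _ _ (borel_rV R d) (borel_rV R d) R S mS mu setT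
  (EFin \o u).
rewrite preimage_setT => /(_ _ (grows_integrable mu6 guS) measurableT) H.
congr fine; rewrite -[LHS]H; last first.
  by case: gu => cu _; apply/measurable_EFinP; exact: continuous_measurable_borel.
by apply: eq_measure_integral => A mA _; exact: muS.
Qed.

Lemma sqnorm_mulmx p (O : 'M[R]_d) : O *m O^T = 1%:M ->
  sqnorm (p *m O) = sqnorm p.
Proof.
have E r : sqnorm r = (r *m r^T) ord0 ord0.
  by rewrite mxE; apply: eq_bigr => i _; rewrite mxE expr2.
by move=> OO; rewrite !E trmx_mul mulmxA -(mulmxA p) OO mulmx1.
Qed.

Lemma invariant_rotation mu (O : 'M[R]_d) :
  (M1norm 6 mu < +oo)%E -> radial mu -> d != 1%N -> rotation O ->
  invariant mu (mulmxr O).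
Proof.
rewrite /radial => mu6 rad /negbTE d1 rO; rewrite d1 in rad.
apply: invariant_image => // [|p|A mA].
- apply: rV_continuous => j; under eq_fun do rewrite mxE.
  apply: sum_continuous => i p.
  by apply: continuousM; [exact: continuous_coord|exact: cst_continuous].
- by apply: sqnorm_mulmx; case: rO.
- exact: rad.
Qed.

Lemma invariant_comp mu (S : 'rV[R]_d -> 'rV[R]_d) (O : 'M[R]_d) :
  rotation O -> invariant mu S -> invariant mu (mulmxr O) ->
  invariant mu (mulmxr O \o S).
Proof.
move=> rO iS iO u gu; rewrite -(iO u gu).
apply: (iS (u \o mulmxr O)); case: gu => cu [K K0 hK]; split.
  move=> p; apply: continuous_comp; last exact: cu.
  apply: rV_continuous => j; under eq_fun do rewrite mxE.
  apply: sum_continuous => i {}p.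
  by apply: continuousM; [exact: continuous_coord|exact: cst_continuous].
exists K => // p; rewrite (le_trans (hK _))//= sqnorm_mulmx//.
by case: rO.
Qed.

(** Sends [(p_a, p_b)] to [(p_b, - p_a)] and fixes the other coordinates. The sign on coordinate [b]
    compensates the determinant -1 of the transposition. *)
Definition quarter_turn (a b : 'I_d) : 'M[R]_d :=
  perm_mx (tperm a b) *m diag_mx (\row_j if j == b then -1 else 1).

Lemma quarter_turnE a b p k : (p *m quarter_turn a b) ord0 k =
  (if k == b then -1 else 1) * p ord0 (tperm a b k).
Proof.
rewrite /quarter_turn -[X in perm_mx X]tpermV mulmxA -col_permE mul_mx_diag.
by rewrite !mxE mulrC.
Qed.

Lemma rotation_quarter_turn a b : a != b -> rotation (quarter_turn a b).
Proof.
move=> ab; split.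
  rewrite /quarter_turn trmx_mul tr_diag_mx mulmxA.
  rewrite -(mulmxA _ (diag_mx _) (diag_mx _)) mulmx_diag.
  have -> : diag_mx (\row_j ((\row_j0 (if j0 == b then -1 else 1)) 0 j *
      (\row_j0 (if j0 == b then -1 else 1)) 0 j)) = 1%:M :> 'M[R]_d.
    rewrite -diag_const_mx; congr diag_mx; apply/rowP => j; rewrite !mxE.
    by case: ifP => _; rewrite ?mulrNN mulr1.
  by rewrite mulmx1 tr_perm_mx tpermV -perm_mxM tperm2 perm_mx1.
rewrite det_mulmx det_perm odd_tperm ab expr1 det_diag (bigD1 b)//= mxE eqxx.
rewrite big1 ?mulr1 ?mulrNN ?mulr1// => i /negbTE ib.
by rewrite mxE ib.
Qed.

End radial_moments.

(** * Integrals of monomials against a radial measure *)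

Section moment_identities.
Context {R : realType} {d : nat}.
Variable mu : posM1 R d.
Hypothesis mu6 : (M1norm 6 mu < +oo)%E.
Hypothesis mu_radial : radial mu.
Implicit Types (p q : 'rV[R]_d) (u : 'rV[R]_d -> R).

Definition rmoment j : R := \int[mu]_p sqnorm p ^+ j.

(** The list of pairs presents an expansion as data: [ring] compares it with the integrand, and
    growth is checked entry by entry. *)
Lemma Rintegral_lincomb (s : seq (R * ('rV[R]_d -> R))) :
  (forall i, (i < size s)%N -> grows 3 (nth (0, fun=> 0) s i).2) ->
  \int[mu]_p (\sum_(t <- s) t.1 * t.2 p) =
  \sum_(t <- s) t.1 * \int[mu]_p t.2 p.
Proof.
elim: s => [|[c u] s IH] gs.
  rewrite big_nil; under eq_Rintegral do rewrite big_nil.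
  by rewrite Rintegral_cst// mul0r.
have gu : grows 3 u := gs 0%N isT.
have {}gs i : (i < size s)%N -> grows 3 (nth (0, fun=> 0) s i).2 := gs i.+1.
rewrite big_cons -(IH gs); under eq_Rintegral do rewrite big_cons.
have gsum : grows 3 (fun p => \sum_(t <- s) t.1 * t.2 p).
  elim: s gs {IH} => [|t s IH] gs.
    under eq_fun do rewrite big_nil.
    exact: growsW (grows_cst 0).
  under eq_fun do rewrite big_cons.
  apply: growsD; first by apply: growsZ; exact: (gs 0%N).
  by apply: IH => i; exact: (gs i.+1).
rewrite (RintegralD _ (grows_integrable mu6 (growsZ c gu))
  (grows_integrable mu6 gsum))//.
by rewrite RintegralZl//; exact: grows_integrable.
Qed.

Lemma Rintegral_sum (I : Type) (r : seq I) (F : I -> 'rV[R]_d -> R) :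
  (forall i, grows 3 (F i)) ->
  \int[mu]_p (\sum_(i <- r) F i p) = \sum_(i <- r) \int[mu]_p F i p.
Proof.
move=> gF; elim: r => [|i r IH].
  rewrite big_nil; under eq_Rintegral do rewrite big_nil.
  by rewrite Rintegral_cst// mul0r.
rewrite big_cons -IH; under eq_Rintegral do rewrite big_cons.
have iF : mu.-integrable setT (EFin \o F i) by exact: grows_integrable.
have isum := grows_integrable mu6 (grows_sum r gF).
by rewrite (RintegralD _ iF isum).
Qed.

Lemma invariant_odd (S : 'rV[R]_d -> 'rV[R]_d) u : invariant mu S -> grows 3 u ->
  (forall p, u (S p) = - u p) -> \int[mu]_p u p = 0.
Proof.
move=> iS gu uS; have := iS u gu; under eq_Rintegral do rewrite uS -mulN1r.
by rewrite RintegralZl//; [lra|exact: grows_integrable].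
Qed.

Lemma sqnorm_quarter_turn a b p : a != b ->
  sqnorm (p *m quarter_turn a b) = sqnorm p.
Proof. by move=> /(rotation_quarter_turn (R := R))[OO _]; exact: sqnorm_mulmx. Qed.

Lemma ord_neq_dim (a b : 'I_d) : a != b -> d != 1%N.
Proof.
apply: contra => /eqP d1; apply/eqP/val_inj; case: a b => [i +] [j +].
by rewrite d1/= !ltnS !leqn0 => /eqP-> /eqP->.
Qed.

Lemma invariant_quarter_turn a b : a != b -> invariant mu (mulmxr (quarter_turn a b)).
Proof.
move=> ab; apply: invariant_rotation => //; first exact: ord_neq_dim ab.
exact: rotation_quarter_turn.
Qed.

(** The square of a quarter turn negates both coordinates of its plane. *)
Lemma invariant_half_turn a b : a != b -> exists S,
  [/\ invariant mu S, forall p, sqnorm (S p) = sqnorm p,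
     forall p, S p ord0 a = - p ord0 a & forall p, S p ord0 b = - p ord0 b].
Proof.
move=> ab; exists (mulmxr (quarter_turn a b) \o mulmxr (quarter_turn a b)).
split => [|p|p|p] /=.
- apply: invariant_comp; [exact: rotation_quarter_turn|exact: invariant_quarter_turn..].
- by rewrite !sqnorm_quarter_turn.
- rewrite !quarter_turnE tpermL tpermR eqxx (negbTE ab); ring.
- rewrite !quarter_turnE tpermR tpermL eqxx (negbTE ab); ring.
Qed.

Lemma invariant_opp : d = 1%N -> invariant mu -%R.
Proof.
move=> /eqP d1; apply: invariant_image => //.
- exact: opp_continuous.
- by move=> p; apply: eq_bigr => i _; rewrite mxE sqrrN.
- by move: mu_radial; rewrite /radial d1 => H A mA; exact: H.
Qed.

(** Indices that are not pairwise distinct take at most two values, so a half turn in one coordinate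
    plane negates all of them; if they all coincide, [d > 1] provides a second axis. For [d = 1]
    evenness gives [p |-> - p] instead. *)
Lemma invariant_flip i j k : ~~ [&& i != j, i != k & j != k] -> exists S,
  [/\ invariant mu S, forall p, sqnorm (S p) = sqnorm p &
      forall l, l \in [:: i; j; k] -> forall p, S p ord0 l = - p ord0 l].
Proof.
move=> ijk; have [d1|d1] := eqVneq d 1%N.
  exists -%R; split => [|p|l _ p]; first exact: invariant_opp.
    by apply: eq_bigr => l _; rewrite mxE sqrrN.
  by rewrite mxE.
have [a [b [ab sub]]] : exists a, exists b,
    a != b /\ {subset [:: i; j; k] <= [:: a; b]}.
  have [ij|ij] := eqVneq i j; last first.
    exists i, j; split => // l.
    rewrite !inE => /or3P[]/eqP->; rewrite ?eqxx ?orbT//.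
    by move: ijk; rewrite ij/= negb_and !negbK ![_ == k]eq_sym.
  have [ik|ik] := eqVneq i k; last first.
    exists i, k; split => // l.
    by rewrite !inE -ij => /or3P[]/eqP->; rewrite ?eqxx ?orbT.
  suff [b ib] : exists b, i != b.
    by exists i, b; split => // l; rewrite !inE -ij -ik !orbb => ->.
  have d2 : (1 < d)%N by case: d i d1 {ij ik ijk} => [[]//|[]].
  exists (if val i == 0%N then Ordinal d2 else Ordinal (ltnW d2)).
  by case: ifP => i0; apply/negP => /eqP/(congr1 val); move: i0 => /= /[swap] ->.
have [S [iS nS Sa Sb]] := invariant_half_turn ab.
exists S; split => // l /sub; rewrite !inE => /orP[]/eqP->; [exact: Sa|exact: Sb].
Qed.

Lemma grows_coord_sqnormX i l : (l <= 2)%N ->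
  grows 3 (fun p => p ord0 i * sqnorm p ^+ l).
Proof. by move=> l2; apply: growsW (growsM (grows_coord i) (grows_sqnormX l)). Qed.

Lemma grows_coord2_sqnormX i j l : (l <= 1)%N ->
  grows 3 (fun p => p ord0 i * p ord0 j * sqnorm p ^+ l).
Proof.
move=> l2; apply: growsW (growsM (grows_coord2 i j) (grows_sqnormX l)).
by rewrite ltnW.
Qed.

Lemma grows_coord3 i j k :
  grows 3 (fun p : 'rV[R]_d => p ord0 i * p ord0 j * p ord0 k).
Proof. exact: growsW (growsM (grows_coord2 i j) (grows_coord k)). Qed.

Lemma Rintegral_coord i l : (l <= 2)%N ->
  \int[mu]_q (q ord0 i * sqnorm q ^+ l) = 0.
Proof.
move=> l2; have [|S [iS nS Si]] := @invariant_flip i i i; first by rewrite eqxx.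
apply: (invariant_odd iS (grows_coord_sqnormX i l2)) => p.
by rewrite Si ?inE ?eqxx// nS mulNr.
Qed.

(** The quarter turn in the plane [(i, j)] changes the sign of [q_i q_j]. *)
Lemma Rintegral_coord2_neq i j l : (l <= 1)%N -> i != j ->
  \int[mu]_q (q ord0 i * q ord0 j * sqnorm q ^+ l) = 0.
Proof.
move=> l1 ij.
apply: (invariant_odd (invariant_quarter_turn ij)
  (grows_coord2_sqnormX i j l1)) => p /=.
rewrite sqnorm_quarter_turn// !quarter_turnE tpermL tpermR eqxx (negbTE ij); ring.
Qed.

(** Quarter turns exchange [q_i^2] and [q_j^2], so the [d] integrals are equal, and they add up to
    [rmoment mu l.+1]. *)
Lemma Rintegral_coord2 i l : (l <= 1)%N ->
  \int[mu]_q (q ord0 i * q ord0 i * sqnorm q ^+ l) = rmoment l.+1 / d%:R.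
Proof.
move=> l1; have E j : \int[mu]_q (q ord0 j * q ord0 j * sqnorm q ^+ l) =
    \int[mu]_q (q ord0 i * q ord0 i * sqnorm q ^+ l).
  have [->//|ij] := eqVneq j i.
  rewrite -(invariant_quarter_turn ij (grows_coord2_sqnormX i i l1)).
  apply: eq_Rintegral => p _ /=.
  by rewrite sqnorm_quarter_turn// !quarter_turnE tpermR eqxx !mulN1r mulrNN.
have -> : rmoment l.+1 = \int[mu]_q (\sum_j q ord0 j * q ord0 j * sqnorm q ^+ l).
  apply: eq_Rintegral => q _; rewrite exprS /sqnorm mulr_suml.
  by apply: eq_bigr => j _; rewrite expr2.
rewrite Rintegral_sum; last by move=> j; exact: grows_coord2_sqnormX.
rewrite (eq_bigr _ (fun j _ => E j)) sumr_const card_ord.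
rewrite -[X in _ = X / _]mulr_natr mulfK//.
by rewrite pnatr_eq0 -lt0n (leq_ltn_trans _ (ltn_ord i)).
Qed.

(** For distinct indices the quarter turn in [(i, j)] fixes [q_k] and changes the sign of [q_i q_j];
    otherwise [invariant_flip] negates all three factors. *)
Lemma Rintegral_coord3 i j k :
  \int[mu]_q (q ord0 i * q ord0 j * q ord0 k) = 0.
Proof.
have [/and3P[ij ik jk]|nijk] := boolP [&& i != j, i != k & j != k].
  apply: (invariant_odd (invariant_quarter_turn ij) (grows_coord3 i j k)) => p /=.
  rewrite !quarter_turnE tpermL tpermR tpermD// eqxx (negbTE ij).
  by rewrite eq_sym (negbTE jk); ring.
have [S [iS _ Si]] := invariant_flip nijk.
apply: (invariant_odd iS (grows_coord3 i j k)) => p.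
by rewrite !Si ?inE ?eqxx ?orbT//; ring.
Qed.

Lemma Rintegral_dotp p l : (l <= 2)%N ->
  \int[mu]_q (dotp p q * sqnorm q ^+ l) = 0.
Proof.
move=> l2; have g i := grows_coord_sqnormX i l2.
under eq_Rintegral do rewrite mulr_suml.
rewrite Rintegral_sum; last first.
  by move=> i; under eq_fun do rewrite -mulrA; exact: growsZ.
rewrite big1// => i _; under eq_Rintegral do rewrite -mulrA.
by rewrite RintegralZl ?Rintegral_coord ?mulr0//; exact: grows_integrable.
Qed.

Lemma Rintegral_dotp2 p l : (l <= 1)%N ->
  \int[mu]_q (dotp p q ^+ 2 * sqnorm q ^+ l) = sqnorm p * (rmoment l.+1 / d%:R).
Proof.
move=> l1; have g i j := grows_coord2_sqnormX i j l1.
have E q : dotp p q ^+ 2 * sqnorm q ^+ l = \sum_i \sum_j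
    p ord0 i * p ord0 j * (q ord0 i * q ord0 j * sqnorm q ^+ l).
  rewrite expr2 big_distrlr mulr_suml; apply: eq_bigr => i _ /=.
  by rewrite mulr_suml; apply: eq_bigr => j _; ring.
under eq_Rintegral do rewrite E.
rewrite Rintegral_sum; last first.
  by move=> i; apply: grows_sum => j; exact: growsZ.
rewrite [in RHS]/sqnorm mulr_suml; apply: eq_bigr => i _.
rewrite Rintegral_sum; last by move=> j; exact: growsZ.
rewrite (bigD1 i)//= big1 ?addr0 => [|j ji].
  rewrite RintegralZl//; last exact: grows_integrable.
  by rewrite Rintegral_coord2// expr2.
rewrite RintegralZl//; last exact: grows_integrable.
by rewrite Rintegral_coord2_neq ?mulr0// eq_sym.
Qed.

Lemma Rintegral_dotp3 p : \int[mu]_q (dotp p q ^+ 3) = 0.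
Proof.
have E q : dotp p q ^+ 3 = \sum_i \sum_j \sum_k
    p ord0 i * p ord0 j * p ord0 k * (q ord0 i * q ord0 j * q ord0 k).
  rewrite exprSr expr2 big_distrlr mulr_suml; apply: eq_bigr => i _ /=.
  rewrite mulr_suml; apply: eq_bigr => j _; rewrite mulr_sumr.
  by apply: eq_bigr => k _; ring.
have g i j k := grows_coord3 i j k.
under eq_Rintegral do rewrite E.
rewrite Rintegral_sum; last first.
  by move=> i; apply: grows_sum => j; apply: grows_sum => k; exact: growsZ.
rewrite big1// => i _; rewrite Rintegral_sum; last first.
  by move=> j; apply: grows_sum => k; exact: growsZ.
rewrite big1// => j _; rewrite Rintegral_sum; last first.
  by move=> k; exact: growsZ.
rewrite big1// => k _; rewrite RintegralZl//; last exact: grows_integrable.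
by rewrite Rintegral_coord3 mulr0.
Qed.

End moment_identities.

(** * Moments of the collision operator *)

Section collision_moments.
Context {R : realType} {d : nat}.
Variable mu : posM1 R d.
Hypothesis d0 : (0 < d)%N.
Hypothesis mu6 : (M1norm 6 mu < +oo)%E.
Hypothesis mu_radial : radial mu.
Implicit Types (p q : 'rV[R]_d).

Local Notation m := (rmoment mu).
Local Notation k := (d%:R^-1 : R).

Let gX j : (j <= 3)%N -> grows 3 (fun q : 'rV[R]_d => sqnorm q ^+ j).
Proof. by move=> j3; exact: growsW (grows_sqnormX j). Qed.

Let gxX p l : (l <= 2)%N -> grows 3 (fun q => dotp p q * sqnorm q ^+ l).
Proof. by move=> l2; apply: growsW (growsM (grows_dotp p) (grows_sqnormX l)). Qed.

Let gx2X p l : (l <= 1)%N -> grows 3 (fun q => dotp p q ^+ 2 * sqnorm q ^+ l).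
Proof.
by move=> l1; apply: growsW (growsM (growsX 2 (grows_dotp p)) (grows_sqnormX l)).
Qed.

Let gx3 p : grows 3 (fun q => dotp p q ^+ 3).
Proof. by have := growsX 3 (grows_dotp p). Qed.

Let rateE p q : rate p q = sqnorm p + sqnorm q - 2 * dotp p q.
Proof. by rewrite /rate enorm_sqr sqnormB. Qed.

Lemma Rintegral_sqnorm_poly (c0 c1 c2 c3 : R) :
  \int[mu]_p (c0 + c1 * sqnorm p + c2 * sqnorm p ^+ 2 + c3 * sqnorm p ^+ 3) =
  c0 * m 0 + c1 * m 1 + c2 * m 2 + c3 * m 3.
Proof.
transitivity (\sum_(t <- [seq (nth 0 [:: c0; c1; c2; c3] j,
    fun p => sqnorm p ^+ j) | j <- iota 0 4]) t.1 * \int[mu]_p t.2 p).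
  rewrite -Rintegral_lincomb//; last by case=> [|[|[|[|]]]]//= _; exact: gX.
  by apply: eq_Rintegral => p _ /=; rewrite !big_cons big_nil /=; ring.
by rewrite /= !big_cons big_nil /= /rmoment; ring.
Qed.

Lemma Rintegral_rate p :
  \int[mu]_q rate p q = sqnorm p * m 0 + m 1.
Proof.
transitivity (\sum_(t <- [:: (sqnorm p, fun q => sqnorm q ^+ 0);
   (1, fun q => sqnorm q ^+ 1); (- 2, fun q => dotp p q * sqnorm q ^+ 0)]) t.1 * \int[mu]_q t.2 q).
  rewrite -Rintegral_lincomb//; last first.
    by case=> [|[|[|]]]//= _; [exact: gX|exact: gX|exact: gxX].
  by apply: eq_Rintegral => q _ /=; rewrite !big_cons big_nil /= rateE; ring.
rewrite !big_cons big_nil /= Rintegral_dotp//.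
rewrite /rmoment; ring.
Qed.

(** [|p - q|^2 |p + q|^2 = (|p|^2 + |q|^2)^2 - 4 (p.q)^2], and [(p.q)^2] integrates in [q] to
    [k |p|^2 m 1]. *)
Lemma Rintegral_rate_sum1 p : \int[mu]_q (rate p q * sqnorm (p + q) ^+ 1) =
  m 2 + (2 - 4 * k) * m 1 * sqnorm p + m 0 * sqnorm p ^+ 2.
Proof.
transitivity (\sum_(t <- [:: (sqnorm p ^+ 2, fun q => sqnorm q ^+ 0);
   (2 * sqnorm p, fun q => sqnorm q ^+ 1); (1, fun q => sqnorm q ^+ 2);
   (- 4, fun q => dotp p q ^+ 2 * sqnorm q ^+ 0)]) t.1 * \int[mu]_q t.2 q).
  rewrite -Rintegral_lincomb//; last first.
    by case=> [|[|[|[|]]]]//= _; [exact: gX|exact: gX|exact: gX|exact: gx2X].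
  by apply: eq_Rintegral => q _ /=; rewrite !big_cons big_nil /= rateE sqnormD; ring.
rewrite !big_cons big_nil /= Rintegral_dotp2//.
rewrite /rmoment; ring.
Qed.

(** With [S = |p|^2 + |q|^2] and [x = p.q], the integrand is [S^3 + 2 x S^2 - 4 x^2 S - 8 x^3]; the
    terms odd in [x] integrate to 0. *)
Lemma Rintegral_rate_sum2 p : \int[mu]_q (rate p q * sqnorm (p + q) ^+ 2) =
  m 3 + (3 - 4 * k) * m 2 * sqnorm p + (3 - 4 * k) * m 1 * sqnorm p ^+ 2
  + m 0 * sqnorm p ^+ 3.
Proof.
transitivity (\sum_(t <- [:: (sqnorm p ^+ 3, fun q => sqnorm q ^+ 0);
   (3 * sqnorm p ^+ 2, fun q => sqnorm q ^+ 1);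
   (3 * sqnorm p, fun q => sqnorm q ^+ 2); (1, fun q => sqnorm q ^+ 3);
   (2 * sqnorm p ^+ 2, fun q => dotp p q * sqnorm q ^+ 0);
   (4 * sqnorm p, fun q => dotp p q * sqnorm q ^+ 1);
   (2, fun q => dotp p q * sqnorm q ^+ 2);
   (- 4 * sqnorm p, fun q => dotp p q ^+ 2 * sqnorm q ^+ 0);
   (- 4, fun q => dotp p q ^+ 2 * sqnorm q ^+ 1);
   (- 8, fun q => dotp p q ^+ 3)]) t.1 * \int[mu]_q t.2 q).
  rewrite -Rintegral_lincomb//; last first.
    do 4 (case; first by move=> _; exact: gX).
    do 3 (case; first by move=> _; exact: gxX).
    do 2 (case; first by move=> _; exact: gx2X).
    by case=> // _; exact: gx3.
  by apply: eq_Rintegral => q _ /=; rewrite !big_cons big_nil /= rateE sqnormD; ring.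
rewrite !big_cons big_nil /= !Rintegral_dotp// !Rintegral_dotp2// Rintegral_dotp3//.
rewrite /rmoment; ring.
Qed.

Lemma Q1_sqnorm :
  [/\ Q1 rate mu (fun p => sqnorm p ^+ 0) = m 0 * m 1,
      Q1 rate mu (fun p => sqnorm p ^+ 1) = m 0 * m 2 + (1 - 2 * k) * m 1 ^+ 2 &
      Q1 rate mu (fun p => sqnorm p ^+ 2) = m 0 * m 3 + (3 - 4 * k) * m 1 * m 2].
Proof.
rewrite /Q1; split.
- rewrite -[X in _ * X = _]/(\int[mu]_p \int[mu]_q (rate p q * 1)).
  under eq_Rintegral => p _.
    under eq_Rintegral do rewrite mulr1.
    rewrite Rintegral_rate (_ : _ + _ = m 1 + m 0 * sqnorm p
      + 0 * sqnorm p ^+ 2 + 0 * sqnorm p ^+ 3); last by ring.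
    over.
  by rewrite Rintegral_sqnorm_poly; field.
- under eq_Rintegral => p _.
    rewrite Rintegral_rate_sum1 (_ : _ + _ = m 2 + (2 - 4 * k) * m 1 * sqnorm p
      + m 0 * sqnorm p ^+ 2 + 0 * sqnorm p ^+ 3); last by ring.
    over.
  by rewrite Rintegral_sqnorm_poly; field; rewrite pnatr_eq0 -lt0n.
- under eq_Rintegral do rewrite Rintegral_rate_sum2.
  by rewrite Rintegral_sqnorm_poly; field; rewrite pnatr_eq0 -lt0n.
Qed.

Lemma Q2_sqnorm j : (j <= 2)%N ->
  Q2 rate mu (fun p => sqnorm p ^+ j) = m 0 * m j.+1 + m 1 * m j.
Proof.
move=> j2; rewrite /Q2; under eq_Rintegral => p _.
  have gr : grows 3 (rate p).
    have -> : rate p = fun q => sqnorm q ^+ 0 * sqnorm p + sqnorm q ^+ 1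
        + (- 2) * (dotp p q * sqnorm q ^+ 0).
      by apply/funext => q /=; rewrite rateE; ring.
    apply: growsD; last by apply: growsZ; exact: gxX.
    apply: growsD; last exact: gX.
    by under eq_fun do rewrite mulrC; apply: growsZ; exact: gX.
  rewrite RintegralZr//; last exact: grows_integrable.
  rewrite Rintegral_rate (_ : (_ + _) * _ =
    m 0 * sqnorm p ^+ j.+1 + m 1 * sqnorm p ^+ j); last first.
    by rewrite exprS; ring.
  over.
rewrite (RintegralD _ (grows_integrable mu6 (growsZ (m 0) (gX (j2 : j.+1 <= 3)%N)))
  (grows_integrable mu6 (growsZ (m 1) (gX (leqW j2)))))//.
by rewrite !RintegralZl//; apply: grows_integrable => //; apply: gX => //; exact: leqW.
Qed.

(** The constants [c_j]. The last one is negative for [d = 1], zero for [d = 2] and positive for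
    larger [d], so the fourth moment need not decay. *)
Definition decay_rate (j : nat) : R :=
  if j is 0 then -1 else if j is 1 then - (2 * k) else 2 - 4 * k.

(** The product [m 0 * m j.+1] occurs in both gain and loss and cancels; this closes the system. *)
Lemma Q_sqnorm j : (j <= 2)%N ->
  Q rate mu (fun p => sqnorm p ^+ j) = decay_rate j * (m 1 * m j).
Proof.
move=> j2; rewrite /Q Q2_sqnorm//; have [E0 E1 E2] := Q1_sqnorm.
by case: j j2 => [|[|[|]]]//= _; rewrite ?E0 ?E1 ?E2; ring.
Qed.

End collision_moments.

(** * Time evolution of the moments *)

Lemma within_continuousM {R : realType} (A : set R) (u v : R -> R) :
  {within A, continuous u} -> {within A, continuous v} ->
  {within A, continuous (fun x => u x * v x)}.
Proof. by move=> cu cv x; apply: cvgM; [exact: cu|exact: cv]. Qed.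

Section time_evolution.
Context {R : realType} {d : nat}.
Variables (fin : posM1 R d) (f : R -> posM1 R d).
Hypothesis d0 : (0 < d)%N.
Hypothesis fin6 : (M1norm 6 fin < +oo)%E.
Hypothesis f_sol : solution (@rate R d) 6 fin f.
Hypothesis f_radial : forall t, 0 <= t -> radial (f t).

Local Notation mu := (@lebesgue_measure R).

Lemma momentE j (nu : posM1 R d) :
  moment j.*2 nu = (\int[nu]_p (sqnorm p ^+ j)%:E)%E.
Proof. by apply: eq_integral => p _; rewrite enorm_even_power. Qed.

Lemma cutpow_integrable j n (nu : posM1 R d) :
  nu.-integrable setT (EFin \o cutpow j n).
Proof.
apply: measurable_bounded_integrable => //.
- exact: fin_num_fun_lty.
- by apply: continuous_measurable_borel; exact: continuous_cutpow.
- exists ((2 * n.+1%:R) ^+ j); split; first exact: num_real.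
  move=> x xn p _; rewrite /= ger0_norm ?cutpow_ge0//.
  by rewrite (le_trans (cutpow_bounded _ _ _))// ltW.
Qed.

(** The limit is taken in the extended reals, since at an individual time the moment is not yet
    known to be finite. *)
Lemma moment_monotone_limit j (nu : posM1 R d) :
  (\int[nu]_p cutpow j n p)%:E @[n --> \oo] --> moment j.*2 nu.
Proof.
rewrite momentE.
have -> : (\int[nu]_p (sqnorm p ^+ j)%:E)%E =
    (\int[nu]_p limn (fun n => (cutpow j n p)%:E))%E.
  apply: eq_integral => p _; apply/esym/cvg_lim => //.
  by apply: cvg_EFin; [exact: nearW|exact: cutpow_cvg].
have -> : (fun n => (\int[nu]_p cutpow j n p)%:E) =
    (fun n => (\int[nu]_p (cutpow j n p)%:E)%E).
  apply/funext => n; rewrite fineK//.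
  exact: integrable_fin_num (cutpow_integrable j n nu).
apply: cvg_monotone_convergence => //.
- move=> n; apply/measurable_EFinP; apply: continuous_measurable_borel.
  exact: continuous_cutpow.
- by move=> n p _; rewrite lee_fin cutpow_ge0.
- move=> p _ m n mn; rewrite lee_fin ler_wpM2r ?exprn_ge0 ?sqnorm_ge0//.
  exact: cutoff_nondecreasing.
Qed.

Lemma cutpow_initial j : (j <= 2)%N ->
  \int[fin]_p cutpow j n p @[n --> \oo] --> rmoment fin j.
Proof.
move=> j2.
have ij := grows_integrable fin6 (growsW (leqW j2) (grows_sqnormX j)).
apply: (borel_dominated_convergence _ _ ij).
- by move=> n; apply: continuous_measurable_borel; exact: continuous_cutpow.
- by move=> p; exact: cutpow_cvg.
- by move=> n p; rewrite ger0_norm ?cutpow_ge0// cutpow_le.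
Qed.

Definition moment_source j s : R :=
  @decay_rate R d j * (rmoment (f s) 1 * rmoment (f s) j).

(* [N] collects the times at which the sixth moment may fail to be controlled. *)
Lemma source_integral j (T : R) : (j <= 2)%N -> 0 < T ->
  exists N : set (measurableTypeR R),
  [/\ measurable N, mu N = 0,
      mu.-integrable (`[0, T] `\` N) (EFin \o moment_source j) &
      forall t, 0 <= t <= T -> moment j.*2 (f t) =
        (rmoment fin j + \int[mu]_(s in `[0, t] `\` N) moment_source j s)%:E].
Proof.
move=> j2 T0; have [_ _ /(_ T T0)[C [N0 [mN0 N00 subN]]] eqf] := f_sol.
(* The almost-everywhere bound concerns the open interval; adding both endpoints to the null set
   makes it hold on all of [[0, T]] minus [N]. *)
pose N := N0 `|` ([set 0] `|` [set T]).
have mN : measurable N by apply: measurableU => //; exact: measurableU.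
have muN : mu N = 0.
  apply: null_set_setU => //; first exact: measurableU.
  by apply: null_set_setU => //; exact: lebesgue_measure_set1.
have good s : s \in `[0, T] -> ~ N s -> (M1norm 6 (f s) <= C%:E)%E.
  rewrite in_itv/= => /andP[s0 sT] Ns; apply: contrapT => h; apply: Ns.
  have [->|s0'] := eqVneq s 0; first by right; left.
  have [->|sT'] := eqVneq s T; first by right; right.
  left; apply: subN => /= h'; apply/h/h'.
  by rewrite in_itv/= !lt_neqAle s0 sT sT' eq_sym s0'.
pose h n s := Q (@rate R d) (f s) (cutpow j n).
pose D t := `[0, t]%classic `\` N.
have mD t : measurable (D t) by apply: measurableD.
have Dg t s : t <= T -> D t s -> (M1norm 6 (f s) <= C%:E)%E /\ 0 <= s.
  move=> tT [/=]; rewrite in_itv/= => /andP[s0 st] Ns; split=> //.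
  by apply: good => //; rewrite in_itv/= s0 (le_trans st tT).
have H t : 0 <= t <= T ->
    mu.-integrable (D t) (EFin \o moment_source j) /\
    \int[mu]_(s in D t) h n s @[n --> \oo] --> \int[mu]_(s in D t) moment_source j s.
  move=> /andP[t0 tT].
  (* The dominating constant combines [Q_cutpow_bound] with [weight_le_M1norm], where [M1norm 6] is
     at most [C]. *)
  apply: (@Rdominated_convergence _ _ R mu (D t) h _ (fun=> 12 * (4 * C) ^+ 2)).
  - exact: mD.
  (* Measurability in time is part of the weak form of the equation. *)
  - move=> n; have [ih _] := eqf _ (@cutpow_compact_support R d j n) t t0.
    have /measurable_EFinP := measurable_int _ ih.
    by apply: measurable_funS => //; exact: subDsetl.
  - move=> s /(Dg _ _ tT)[sC s0].
    have s6 : (M1norm 6 (f s) < +oo)%E by exact: le_lt_trans (ltry C).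
    rewrite /moment_source -Q_sqnorm//; last exact: f_radial.
    exact: Q_cutpow_cvg.
  - have ic : mu.-integrable `[0, t] (EFin \o (fun=> 12 * (4 * C) ^+ 2)).
      apply: continuous_compact_integrable; first exact: segment_compact.
      by apply: continuous_subspaceT => s; exact: cst_continuous.
    by apply: integrableS ic; [|exact: mD|exact: subDsetl].
  - move=> n s /(Dg _ _ tT)[sC s0].
    have s6 : (M1norm 6 (f s) < +oo)%E by exact: le_lt_trans (ltry C).
    rewrite (le_trans (Q_cutpow_bound _ _ _))// ler_wpM2l// lerXn2r// ?nnegrE.
    + by apply: Rintegral_ge0 => p _; exact: weight_ge0.
    + rewrite mulr_ge0// -lee_fin (le_trans _ sC)// integral_ge0// => p _.
      by rewrite lee_fin addr_ge0// exprn_ge0// sqrtr_ge0.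
    + rewrite (le_trans (weight_le_M1norm s6))// ler_wpM2l// -lee_fin fineK//.
      rewrite ge0_fin_numE// integral_ge0// => p _.
      by rewrite lee_fin addr_ge0// exprn_ge0// sqrtr_ge0.
exists N; split => //; first by have [] := H T; rewrite ?lexx ?ltW.
move=> t tT; have [t0 _] := andP tT.
(* One sequence has two limits: the moment, by monotone convergence in space, and the right-hand
   side, by dominated convergence in time. Hence the moment is finite at every time, including those
   in [N]. *)
rewrite -(cvg_lim _ (@moment_monotone_limit j (f t)))//; apply: cvg_lim => //.
apply: cvg_EFin; first exact: nearW.
have -> : (fine \o (fun n => (\int[f t]_p cutpow j n p)%:E)) =
    (fun n => \int[fin]_p cutpow j n p + \int[mu]_(s in D t) h n s).
  apply/funext => n /=.
  have [ih ->] := eqf _ (@cutpow_compact_support R d j n) t t0.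
  by rewrite /Rintegral (negligible_integral mN _ ih muN).
by apply: cvgD; [exact: cutpow_initial|exact: (H t tT).2].
Qed.

(** By [source_integral] the moment is, up to a constant, the integral over [[0, t]] of an
    integrable function. *)
Lemma continuous_moment j (T : R) : (j <= 2)%N -> 0 < T ->
  {within `[0, T], continuous (fun t => rmoment (f t) j)}.
Proof.
move=> j2 T0; have [N [mN _ iN E]] := source_integral j2 T0.
(* Extension by zero on [N] turns integrals over [[0, t]] minus [N] into integrals over [[0, t]]. *)
pose g := moment_source j \_ (~` N).
have ig : mu.-integrable `[0, T] (EFin \o g).
  have := (integrable_restrict mu (measurableC mN) (measurable_itv `[0, T])
    (EFin \o moment_source j)).1.
  by rewrite -setDE restrict_EFin; exact.
have cF : {within `[0, T], continuous
    (fun t => rmoment fin j + \int[mu]_(s in `[0, t]) g s)}.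
  move=> t; apply: (@continuousD _ _ (subspace `[0, T]%classic)).
    exact: cst_continuous.
  exact: (parameterized_integral_continuous (ltW T0) ig).
apply: subspace_eq_continuous cF => t.
rewrite inE/= in_itv/= => tT.
rewrite [RHS]/(fine (\int[f t]_p (sqnorm p ^+ j)%:E)) -momentE E//=.
by rewrite setDE Rintegral_mkcondr.
Qed.

Lemma continuous_source j (T : R) : (j <= 2)%N -> 0 < T ->
  {within `[0, T], continuous (moment_source j)}.
Proof.
move=> j2 T0; apply: within_continuousM.
  by apply: continuous_subspaceT => t; exact: cst_continuous.
by apply: within_continuousM; exact: continuous_moment.
Qed.

(** The source is now known to be continuous, hence integrable on [[0, t]], so the null set
    disappears from the integral. *)
Lemma moment_equation j (t : R) : (j <= 2)%N -> 0 <= t ->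
  moment j.*2 (f t) = (rmoment (f t) j)%:E /\
  rmoment (f t) j = rmoment (f 0) j + \int[mu]_(s in `[0, t]) moment_source j s.
Proof.
(* The horizon [t + 1] is positive even when [t = 0]. *)
move=> j2 t0; have T0 : 0 < t + 1 by rewrite ltr_wpDl.
have [N [mN N0 _ E]] := source_integral j2 T0.
have E' s : 0 <= s <= t + 1 -> moment j.*2 (f s) =
    (rmoment fin j + \int[mu]_(r in `[0, s]) moment_source j r)%:E.
  move=> /[dup] /andP[s0 sT] /E ->.
  have ig : mu.-integrable `[0, s] (EFin \o moment_source j).
    apply: continuous_compact_integrable; first exact: segment_compact.
    apply: continuous_subspaceW (continuous_source j2 T0).
    by apply: subset_itvl; rewrite bnd_simp.
  by rewrite /Rintegral (negligible_integral mN _ ig N0).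
have F s : 0 <= s <= t + 1 -> rmoment (f s) j =
    rmoment fin j + \int[mu]_(r in `[0, s]) moment_source j r.
  by move=> /E' Es; rewrite [LHS]/(fine (\int[f s]_p (sqnorm p ^+ j)%:E)) -momentE Es.
have t01 : 0 <= t <= t + 1 by rewrite t0 lerDl ler01.
split; first by rewrite F// E'.
(* At time 0 the integral is over a point, so [fin] and [f 0] have the same moment. *)
rewrite (F t)// (F 0) ?lexx ?(ltW T0)//.
by rewrite set_itv1 Rintegral_set1 addr0.
Qed.

End time_evolution.

(** * The moment equations *)

Section linear_ode.
Context {R : realType}.
Local Notation mu := (@lebesgue_measure R).

Lemma is_derive_integral (T t : R) (u : R -> R) :
  {within `[0, T], continuous u} -> t \in `]0, T[ ->
  is_derive t 1 (fun t => \int[mu]_(s in `[0, t]) u s) (u t).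
Proof.
move=> cu tT; move: (tT); rewrite in_itv/= => /andP[t0 tT'].
have iu : mu.-integrable `[0, T] (EFin \o u).
  by apply: continuous_compact_integrable => //; exact: segment_compact.
have cut := within_continuous_continuous (lt_trans t0 tT') cu tT.
have [dF F'] := continuous_FTC1_closed tT' iu t0 cut.
by apply: DeriveDef => //; rewrite -derive1E.
Qed.

Lemma within_continuous_integral (T : R) (u : R -> R) : 0 < T ->
  {within `[0, T], continuous u} ->
  {within `[0, T], continuous (fun t => \int[mu]_(s in `[0, t]) u s)}.
Proof.
move=> T0 cu; apply: (parameterized_integral_continuous (ltW T0)).
by apply: continuous_compact_integrable => //; exact: segment_compact.
Qed.

(** Integrating factor: [x] times [exp(- c E)], with [E] the integral of [m], has zero derivative
    inside [[0, T]] and is continuous up to the endpoints, hence is constant. *)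
Lemma linear_ode (m x : R -> R) (c T : R) : 0 < T ->
  {within `[0, T], continuous m} -> {within `[0, T], continuous x} ->
  (forall t, 0 <= t <= T -> x t = x 0 + \int[mu]_(s in `[0, t]) (c * (m s * x s))) ->
  x T = x 0 * expR (c * \int[mu]_(s in `[0, T]) m s).
Proof.
move=> T0 cm cx xE.
have cK (a : R) : {within `[0, T], continuous (fun=> a)}.
  by apply: continuous_subspaceT => t; exact: cst_continuous.
pose E t := \int[mu]_(s in `[0, t]) m s.
(* [X] agrees with [x] on [[0, T]] and is differentiable inside by the fundamental theorem of
   calculus. *)
pose X t := x 0 + \int[mu]_(s in `[0, t]) (c * (m s * x s)).
have cmx : {within `[0, T], continuous (fun s => c * (m s * x s))}.
  by do 2 (apply: within_continuousM => //).
have dE t : t \in `]0, T[ -> is_derive t 1 E (m t) by exact: is_derive_integral.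
have dX t : t \in `]0, T[ -> is_derive t 1 X (c * (m t * X t)).
  move=> tT; have tT' : 0 <= t <= T.
    by move: tT; rewrite in_itv/= => /andP[/ltW-> /ltW->].
  rewrite -[c * _]add0r /X -xE//; apply: is_deriveD.
  exact: (is_derive_integral cmx tT).
pose y t := X t * expR (- c * E t).
have dy t : t \in `]0, T[ -> is_derive t 1 y 0.
  move=> tT; have h1 := dX t tT; have h2 := dE t tT.
  have h3 : is_derive t 1 (fun t => - c * E t) (- c * m t) by exact: is_deriveZ.
  have h4 := @is_derive1_comp _ expR (fun t => - c * E t) _ _ _ (is_derive_expR _) h3.
  have := is_deriveM h1 h4.
  rewrite (_ : _ + _ = 0) //= /GRing.scale/=; ring.
have cy : {within `[0, T], continuous y}.
  apply: within_continuousM.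
    move=> t; apply: cvgD; [exact: cK|exact: within_continuous_integral].
  have h : {within `[0, T], continuous (fun t => - c * E t)}.
    by apply: within_continuousM => //; exact: within_continuous_integral.
  by move=> t; apply: continuous_comp; [exact: h|exact: continuous_expR].
have [z _] := MVT_segment (ltW T0) dy cy.
rewrite mul0r => /eqP; rewrite subr_eq0 => /eqP.
rewrite /y /X /E -xE ?lexx ?(ltW T0)// set_itv1 !Rintegral_set1.
rewrite addr0 mulr0 expR0 mulr1.
move=> <-; rewrite -mulrA -expRD mulNr addNr expR0 mulr1//.
Qed.

(** The function [w = exp(c E)] has derivative [c m w], which is the constant [c * m 0] because
    [m = m 0 / w]; so [w] is affine. *)
Lemma expR_integral_decay (m : R -> R) (c T : R) : 0 < T ->
  {within `[0, T], continuous m} ->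
  (forall t, 0 <= t <= T ->
    m t = m 0 * expR (- c * \int[mu]_(s in `[0, t]) m s)) ->
  expR (c * \int[mu]_(s in `[0, T]) m s) = 1 + c * m 0 * T.
Proof.
move=> T0 cm mE.
pose E t := \int[mu]_(s in `[0, t]) m s.
pose w t := expR (c * E t).
have dw t : t \in `]0, T[ -> is_derive t 1 w (c * m 0).
  move=> tT; have tT' : 0 <= t <= T.
    by move: tT; rewrite in_itv/= => /andP[/ltW-> /ltW->].
  have h2 : is_derive t 1 E (m t) by exact: is_derive_integral.
  have h3 : is_derive t 1 (fun t => c * E t) (c * m t) by exact: is_deriveZ.
  have := @is_derive1_comp _ expR (fun t => c * E t) _ _ _ (is_derive_expR _) h3.
  rewrite (mE t tT') -/(E t); set e := expR _; set e' := expR _.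
  have -> : e * (c * (m 0 * e')) = c * m 0 * (e' * e) by ring.
  by rewrite -expRD mulNr addNr expR0 mulr1.
have cw : {within `[0, T], continuous w}.
  have h : {within `[0, T], continuous (fun t => c * E t)}.
    apply: within_continuousM; last exact: within_continuous_integral.
    by apply: continuous_subspaceT => t; exact: cst_continuous.
  by move=> t; apply: continuous_comp; [exact: h|exact: continuous_expR].
have [z _] := MVT_segment (ltW T0) dw cw.
rewrite /w /E set_itv1 Rintegral_set1 mulr0 expR0 subr0 -/(E T) => <-.
by rewrite addrC subrK.
Qed.

End linear_ode.

(** * Moments in terms of the integral of the second moment *)

Section explicit_moments.
Context {R : realType} {d : nat}.
Variables (fin : posM1 R d) (f : R -> posM1 R d).
Hypothesis d0 : (0 < d)%N.
Hypothesis fin6 : (M1norm 6 fin < +oo)%E.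
Hypothesis f_sol : solution (@rate R d) 6 fin f.
Hypothesis f_radial : forall t, 0 <= t -> radial (f t).

Local Notation mu := (@lebesgue_measure R).

Let E t := \int[mu]_(s in `[0, t]) rmoment (f s) 1.

Lemma moment_expR j t : (j <= 2)%N -> 0 <= t ->
  rmoment (f t) j = rmoment (f 0) j * expR (@decay_rate R d j * E t).
Proof.
move=> j2; rewrite le_eqVlt => /predU1P[<-|t0].
  by rewrite /E set_itv1 Rintegral_set1 mulr0 expR0 mulr1.
apply: (linear_ode (m := fun s => rmoment (f s) 1)
  (x := fun s => rmoment (f s) j)) => //.
- exact: (continuous_moment d0 fin6 f_sol f_radial).
- exact: (continuous_moment d0 fin6 f_sol f_radial).
- move=> s /andP[s0 _].
  by have [_ ->] := moment_equation d0 fin6 f_sol f_radial j2 s0.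
Qed.

Lemma expR_integral_moment t : 0 <= t ->
  expR (2 * d%:R^-1 * E t) = 1 + 2 * d%:R^-1 * rmoment (f 0) 1 * t.
Proof.
rewrite le_eqVlt => /predU1P[<-|t0].
  by rewrite /E set_itv1 Rintegral_set1 !mulr0 expR0 addr0.
apply: expR_integral_decay => //.
  exact: (continuous_moment d0 fin6 f_sol f_radial).
by move=> s /andP[s0 _]; rewrite (@moment_expR 1).
Qed.

End explicit_moments.

Theorem lemma9 (R : realType) (d : nat) (hd : (0 < d)%N) :
  exists k : R, [/\ 0 < k, d = 1%N -> k = 1 &
    forall fin : posM1 R d, (M1norm 6 fin < +oo)%E -> radial fin ->
    forall f : R -> posM1 R d,
      solution (fun p p' : 'rV[R]_d => enorm (p - p') ^+ 2) 6 fin f ->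
      (forall t : R, 0 <= t -> radial (f t)) ->
    let M (n : nat) (t : R) : \bar R := moment n (f t) in
    let B (t : R) : R := 1 + 2 * k * fine (M 2%N 0) * t in
    forall t : R, 0 <= t ->
      [/\ M 0%N t = (M 0%N 0%R / (B t `^ (1 / (2 * k)))%:E)%E,
          M 2%N t = (((M 2%N 0%R)^-1 + (2 * k * t)%:E)^-1)%E &
          M 4%N t = (M 4%N 0%R * (B t `^ (1 / k - 2))%:E)%E]].
Proof.
have dR : 0 < d%:R :> R by rewrite ltr0n.
exists d%:R^-1; split; [by rewrite invr_gt0|by move=> ->; rewrite invr1|].
move=> fin fin6 _ f f_sol f_radial M B t t0.
have ME j s : (j <= 2)%N -> 0 <= s -> moment j.*2 (f s) = (rmoment (f s) j)%:E.
  by move=> j2 s0; have [] := moment_equation hd fin6 f_sol f_radial j2 s0.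
pose x j := rmoment (f 0) j.
pose I := \int[@lebesgue_measure R]_(s in `[0, t]) rmoment (f s) 1.
have xE j : (j <= 2)%N -> rmoment (f t) j = x j * expR (@decay_rate R d j * I).
  by move=> j2; exact: (moment_expR hd fin6 f_sol f_radial).
have BE : B t = expR (2 * d%:R^-1 * I).
  rewrite (expR_integral_moment hd fin6 f_sol f_radial t0) /B /M.
  by rewrite (ME 1%N 0).
(* Every power of [B t] is an exponential of a multiple of [I], so the formulas for orders 0 and 4
   reduce to comparing exponents with [c_0] and [c_2]. *)
have powB a : B t `^ a = expR (a * (2 * d%:R^-1 * I)).
  by rewrite BE /powR gt_eqF ?expR_gt0// expRK.
have B0 : 0 < B t by rewrite BE expR_gt0.
have x1 : fine (M 2%N 0) = x 1%N by rewrite /M (ME 1%N 0).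
rewrite /M (ME 0%N t)// (ME 1%N t)// (ME 2%N t)// (ME 0%N 0)// (ME 1%N 0)// (ME 2%N 0)//.
rewrite !xE// !powB -/(x 0%N) -/(x 1%N) -/(x 2%N); split.
- rewrite inver gt_eqF ?expR_gt0// -EFinM -expRN; congr (_ * expR _)%:E.
  by rewrite /=; field; rewrite gt_eqF.
(* If the second moment vanishes initially, its extended inverse is [+oo]; the sum stays [+oo] and
   inverts to 0. Otherwise [exp(- 2 k I)] is the inverse of [B t], and [B t] is [x 1] times the
   denominator. *)
- rewrite inver; case: eqP => [->|/eqP x10].
    by rewrite mul0r addye.
  have xp : 0 < x 1%N.
    rewrite lt_neqAle eq_sym x10/=; apply: Rintegral_ge0 => p _.
    by rewrite exprn_ge0// sqnorm_ge0.
  have D0 : 0 < (x 1%N)^-1 + 2 * d%:R^-1 * t.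
    by rewrite ltr_pwDl ?invr_gt0// !mulr_ge0// invr_ge0 ltW.
  rewrite -EFinD inver gt_eqF//; congr (_%:E).
  rewrite /= mulNr expRN -BE /B x1.
  have : B t != 0 by rewrite gt_eqF.
  by rewrite /B x1 => Bn0; field; rewrite ?gt_eqF// ltr_pwDl// !mulr_ge0// ltW.
(* [(1/k - 2) * 2 k = 2 - 4 k]. *)
- rewrite -EFinM; congr (_ * expR _)%:E.
  by rewrite /=; field; rewrite gt_eqF.
Qed.
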